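(* Let $Q,T_1,T_2,X\in\mathcal{B}(\mathcal{H})$ be such that $T_1$, $T_2$ and $T_2Q$ are contractions and $T_1X=XT_2Q$. Let $V_1\in\mathcal{B}(\mathcal{K}_1)$ and $V_2\in\mathcal{B}(\mathcal{K}_2)$ be any co-isometric extensions of $T_1$ and $T_2$ respectively, where $\mathcal{K}_1,\mathcal{K}_2\supseteq\mathcal{H}$. Let $\overline{Q}\in\mathcal{B}(\mathcal{K}_2)$ be any extension of $Q$ such that $V_2\overline{Q}$ is a contraction. Then there is a norm preserving extension $Y:\mathcal{K}_2\to\mathcal{K}_1$ of $X$ such that $V_1Y=YV_2\overline{Q}$.
   Context: All Hilbert spaces are complex; $\mathcal{B}(\mathcal{H})$ is the algebra of bounded linear operators on $\mathcal{H}$; containment of Hilbert spaces means containment as a closed linear subspace; a contraction is an operator of norm at most one. For $\mathcal{H}\subseteq\mathcal{K}$, $B\in\mathcal{B}(\mathcal{K})$ is an extension of $A\in\mathcal{B}(\mathcal{H})$ if $Bh=Ah$ for all $h\in\mathcal{H}$ (so $\mathcal{H}$ is invariant under $B$); it is a co-isometric extension if in addition $BB^*=I_{\mathcal{K}}$. Similarly $Y\in\mathcal{B}(\mathcal{K}_2,\mathcal{K}_1)$ is an extension of $X\in\mathcal{B}(\mathcal{H})$ if $Yh=Xh$ for all $h\in\mathcal{H}$, where $\mathcal{H}$ is regarded as a subspace of both $\mathcal{K}_2$ and $\mathcal{K}_1$; it is norm preserving if $\|Y\|=\|X\|$. *)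

(* Defs.v *)
From HB Require Import structures.
From mathcomp Require Import all_boot all_order all_algebra.
From mathcomp Require Import sesquilinear complex.
From mathcomp Require Import all_classical all_reals all_analysis.

Set Implicit Arguments.
Unset Strict Implicit.
Unset Printing Implicit Defensive.
Import Order.TTheory GRing.Theory Num.Theory.
Import numFieldNormedType.Exports.
Local Open Scope classical_set_scope.
Local Open Scope ring_scope.
Local Open Scope complex_scope.

(** Complex Hilbert spaces: complete normed spaces over [R[i]] whose norm comes
    from an inner product, linear in its first argument. *)
HB.mixin Record CompleteNormedModule_isHilbert (R : realType) H
    of CompleteNormedModule R[i] H := {
  inner : {dot H for Num.conj};
  inner_norm : forall x : H, inner x x = `|x| ^+ 2
}.

#[short(type="hilbertType")]
HB.structure Definition Hilbert (R : realType) :=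
  {H of CompleteNormedModule R[i] H & CompleteNormedModule_isHilbert R H}.

Notation "'[< x , y >]" := (inner x y)
  (at level 2, x at level 99, y at level 99, format "''[<' x ,  y '>]'")
  : ring_scope.

HB.mixin Record isBoundedOp (R : realType) (H K : hilbertType R) (f : H -> K) := {
  boundedop_subproof : exists M : R, forall x : H, `|f x| <= M%:C * `|x|
}.

#[short(type="boundedOp")]
HB.structure Definition BoundedOp (R : realType) (H K : hilbertType R) :=
  {f of @GRing.Linear R[i] H K *:%R f & @isBoundedOp R H K f}.

Notation "''B' ( H , K )" := (boundedOp H%type K%type)
  (at level 8, format "''B' ( H ,  K )") : type_scope.
Notation "''B' ( H )" := (boundedOp H%type H%type)
  (at level 8, format "''B' ( H )") : type_scope.

Section Operators.
Variable R : realType.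
Implicit Types H K L : hilbertType R.

Lemma comp_boundedop H K L (g : 'B(K, L)) (f : 'B(H, K)) :
  exists M : R, forall x : H, `|(g \o f) x| <= M%:C * `|x|.
Proof.
have [M1 h1] := @boundedop_subproof _ _ _ g.
have [M2 h2] := @boundedop_subproof _ _ _ f.
exists (`|M1| * M2) => x /=; apply: (le_trans (h1 _)).
apply: (@le_trans _ _ (`|M1|%:C * `|f x|)).
  by rewrite ler_wpM2r // lecR ler_norm.
by rewrite rmorphM /= -mulrA ler_wpM2l ?h2 // ler0c.
Qed.

HB.instance Definition _ H K L (g : 'B(K, L)) (f : 'B(H, K)) :=
  @isBoundedOp.Build R H L (g \o f) (comp_boundedop g f).

(** [`|f x|] is a nonnegative real element of [R[i]]; [Re] recovers it in [R]. *)
Definition opnorm H K (f : 'B(H, K)) : R :=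
  sup [set complex.Re `|f x| | x in [set x : H | `|x| <= 1]].

Lemma opnormP H K (f : 'B(H, K)) (x : H) : `|f x| <= (opnorm f)%:C * `|x|.
Proof.
have normE (V : hilbertType R) (v : V) : `|v| = (complex.Re `|v|)%:C.
  by have /ger0_Im := normr_ge0 v; case: (`|v|) => a b /= ->.
have [M hM] := @boundedop_subproof _ _ _ f.
have [->|x0] := eqVneq x 0; first by rewrite linear0 !normr0 mulr0.
have nx0 : 0 < `|x| by rewrite normr_gt0.
rewrite -ler_pdivrMr // mulrC.
rewrite -[X in X * _]ger0_norm ?invr_ge0 ?(ltW nx0) // -normrZ -linearZ.
rewrite (normE K) lecR; apply: ub_le_sup; last first.
  exists (`|x|^-1 *: x) => //=.
  by rewrite normrZ ger0_norm ?invr_ge0 ?(ltW nx0) // mulVf ?gt_eqF.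
exists `|M| => _ [y /= y1 <-]; rewrite -lecR -normE.
apply: (le_trans (hM y)); apply: (@le_trans _ _ (`|M|%:C * `|y|)).
  by rewrite ler_wpM2r // lecR ler_norm.
by rewrite ler_piMr // ler0c.
Qed.

Definition contraction_op H K (f : 'B(H, K)) : Prop := opnorm f <= 1.

(** The adjoint, picked pointwise by its defining property; the vector [z]
    exists by the Riesz representation theorem. *)
Definition adjoint H K (f : 'B(H, K)) (y : K) : H :=
  xget 0 [set z : H | forall x : H, '[< f x, y >] = '[< x, z >]].

Lemma adjoint_unique H K (f : 'B(H, K)) (y : K) (z : H) :
  (forall x : H, '[< f x, y >] = '[< x, z >]) -> adjoint f y = z.
Proof.
move=> hz; rewrite /adjoint; case: xgetP => [w _ /= hw|/(_ z)/(_ hz)//].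
apply/eqP; rewrite -subr_eq0 -normr_eq0 -sqrf_eq0 -inner_norm.
by rewrite linearBr /= -hw hz subrr.
Qed.

Definition coisometric H (V : 'B(H)) : Prop := forall x : H, V (adjoint V x) = x.

(** [H] sits in [K] as a closed subspace through a linear map [J] preserving
    inner products; its range is closed because [H] is complete. *)
Definition embedding H K (J : {linear H -> K}) : Prop :=
  forall x y : H, '[< J x, J y >] = '[< x, y >].

(** [Y : K2 -> K1] extends [X : H -> H], where [H] is contained in [K2] and [K1]
    through [J2] and [J1]. *)
Definition extends H K1 K2 (J1 : {linear H -> K1}) (J2 : {linear H -> K2})
    (X : 'B(H)) (Y : 'B(K2, K1)) : Prop :=
  forall h : H, Y (J2 h) = J1 (X h).

Definition coisometric_extension H K (J : {linear H -> K})
    (T : 'B(H)) (V : 'B(K)) : Prop :=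
  extends J J T V /\ coisometric V.

Definition norm_preserving H K1 K2 (X : 'B(H)) (Y : 'B(K2, K1)) : Prop :=
  opnorm Y = opnorm X.

End Operators.

(* Main.v *)
From HB Require Import structures.
Require Import Defs.
From mathcomp Require Import all_boot all_order all_algebra.
From mathcomp Require Import sesquilinear complex.
From mathcomp Require Import all_classical all_reals all_analysis.
From mathcomp Require Import ring lra.

Set Implicit Arguments.
Unset Strict Implicit.
Unset Printing Implicit Defensive.
Import Order.TTheory GRing.Theory Num.Theory.
Import numFieldNormedType.Exports.
Local Open Scope classical_set_scope.
Local Open Scope ring_scope.
Local Open Scope complex_scope.

(** Put [W = V2 Qbar], [A = J1 X], [S = T2 Q] and [c = opnorm X].  Then [W] is
    a contraction with [W J2 = J2 S], and [V1 A = A S] because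
    [T1 X = X T2 Q].  The theorem becomes: extend [A] along [J2] to an operator
    [Y] with [V1 Y = Y W] and norm at most [c]
    ([intertwining_extension]); an extension of [X] has norm at least [c].

    The equation is first solved with different operators on its two sides.
    Given any extension [Y] of [A] bounded by [c], the problem
    [V1 Y' = Y W], [Y' J2 = A], [|Y'| <= c] is a two-by-two completion problem
    of Parrott's kind, since [V1] being co-isometric means that only the
    component of [Y'] in the range of the adjoint of [V1] is prescribed.  It is
    solvable ([parrott_extension]).  Iteration gives a bounded sequence with
    [V1 Y_(n+1) = Y_n W], and a weak limit of it taken along a shift-invariant
    Banach limit satisfies [V1 Y = Y W].

    The component of [Y'] in the kernel of [V1] must be an extension of the
    corresponding component [C] of [A], with
    [|C' k|^2 <= c^2 |k|^2 - |Y W k|^2].  The right-hand side is a semi-norm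
    [g] coming from a positive form, so one may take [C' = C P], with [P] the
    [g]-orthogonal projection onto the range of [J2]
    ([contraction_extension]).  As [g] may be degenerate and its space
    incomplete, [P k] is replaced by approximate projections, whose images
    under [C] converge.

    Everything is done with the real parts of the inner products, which
    determine them by complex linearity. *)

(** * Positive semi-definite forms *)

Section SemiInner.
Variable R : realType.

Lemma quadratic_ge0_discr (a b c : R) :
  0 <= c -> (forall t, 0 <= a + t * b *+ 2 + t ^+ 2 * c) -> b ^+ 2 <= a * c.
Proof.
rewrite le_eqVlt => /predU1P[<-|c0] h; last first.
  have c0' : c != 0 by rewrite gt_eqF.
  have := h (- b / c); rewrite -(pmulr_rge0 _ c0).
  by rewrite (_ : c * _ = a * c - b ^+ 2) ?subr_ge0 //; field.
have [->|b0] := eqVneq b 0; first by rewrite mulr0 expr0n.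
(* For c = 0 and b <> 0 the affine function takes the value -1. *)
have := h (- (a + 1) / (b *+ 2)).
rewrite mulr0 addr0 -mulrnAr divfK; last by rewrite mulrn_eq0.
by rewrite opprD addrA subrr add0r lerNr oppr0 ler10.
Qed.

(** The real part of a positive semi-definite Hermitian form. The rule
    [semi_innerZl] is what remains of sesquilinearity in the real part; it is
    the reason why maps obtained from [g] are complex linear. *)
Record semi_inner (E : lmodType R[i]) (g : E -> E -> R) : Prop := SemiInner {
  semi_innerC : forall x y, g x y = g y x;
  semi_innerDl : forall x y z, g (x + y) z = g x z + g y z;
  semi_innerRZl : forall (t : R) x y, g (t%:C *: x) y = t * g x y;
  semi_innerZl : forall (a : R[i]) x y, g (a *: x) y = g x (Num.conj a *: y);
  semi_inner_ge0 : forall x, 0 <= g x x }.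

Definition nrm (V : normedZmodType R[i]) (x : V) : R := complex.Re `|x|.

Lemma normE (V : normedZmodType R[i]) (x : V) : `|x| = (nrm x)%:C.
Proof.
by have /ger0_Im := normr_ge0 x; rewrite /nrm; case: (`|x|) => a b /= ->.
Qed.

Lemma nrm_ge0 (V : normedZmodType R[i]) (x : V) : 0 <= nrm x.
Proof. by rewrite -ler0c -normE. Qed.

Section Theory.
Variables (E : lmodType R[i]) (g : E -> E -> R).
Hypothesis gP : semi_inner g.

Lemma semi_innerDr x y z : g x (y + z) = g x y + g x z.
Proof.
by rewrite (semi_innerC gP) (semi_innerDl gP) !(semi_innerC gP _ x).
Qed.

Lemma semi_innerRZr (t : R) x y : g x (t%:C *: y) = t * g x y.
Proof.
by rewrite (semi_innerC gP) (semi_innerRZl gP) (semi_innerC gP).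
Qed.

Lemma semi_innerNl x y : g (- x) y = - g x y.
Proof.
have := semi_innerRZl gP (-1) x y.
by rewrite rmorphN1 scaleN1r mulN1r.
Qed.

Lemma semi_innerNr x y : g x (- y) = - g x y.
Proof. by rewrite (semi_innerC gP) semi_innerNl (semi_innerC gP). Qed.

Lemma semi_inner0r x : g x 0 = 0.
Proof. by rewrite -(scale0r (0 : E)) (semi_innerRZr 0) mul0r. Qed.

Lemma semi_inner_line x y (t : R) :
  g (x + t%:C *: y) (x + t%:C *: y) = g x x + t * g x y *+ 2 + t ^+ 2 * g y y.
Proof.
rewrite (semi_innerDl gP) !semi_innerDr !(semi_innerRZl gP) !semi_innerRZr.
by rewrite (semi_innerC gP y x); ring.
Qed.

Lemma semi_inner_CauchySchwarz x y : g x y ^+ 2 <= g x x * g y y.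
Proof.
apply: quadratic_ge0_discr; first exact: semi_inner_ge0 gP y.
by move=> t; rewrite -semi_inner_line (semi_inner_ge0 gP).
Qed.

Definition snorm x := Num.sqrt (g x x).

Lemma snorm_ge0 x : 0 <= snorm x. Proof. exact: sqrtr_ge0. Qed.

Lemma sqr_snorm x : snorm x ^+ 2 = g x x.
Proof. by rewrite sqr_sqrtr ?(semi_inner_ge0 gP). Qed.

Lemma snormN x : snorm (- x) = snorm x.
Proof. by rewrite /snorm semi_innerNl semi_innerNr opprK. Qed.

Lemma le_snorm_CauchySchwarz x y : `|g x y| <= snorm x * snorm y.
Proof.
have g0 := semi_inner_ge0 gP.
rewrite -sqrtrM // -sqrtr_sqr ler_sqrt ?semi_inner_CauchySchwarz //.
by rewrite mulr_ge0.
Qed.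

Lemma snormZ (a : R[i]) x : snorm (a *: x) = nrm a * snorm x.
Proof.
apply/eqP; rewrite -(@eqrXn2 _ 2) ?mulr_ge0 ?snorm_ge0 ?nrm_ge0 //.
rewrite exprMn !sqr_snorm (semi_innerZl gP) scalerA mulrC -normCK.
by rewrite normE -rmorphXn /= semi_innerRZr.
Qed.

Lemma snorm_dual_le x d :
  0 <= d -> (forall y, g y x <= d * snorm y) -> snorm x <= d.
Proof.
move=> d0 /(_ x); rewrite -sqr_snorm expr2.
have := snorm_ge0 x; rewrite le_eqVlt => /predU1P[<- //|x0].
by rewrite ler_pM2r.
Qed.

(** A Riesz representation theorem that survives degeneracy and incompleteness:
    a point [e] where [g x x - 2 rho x] is within [d ^+ 2] of its infimum
    represents [rho] up to [d], by the discriminant of the quadratic polynomial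
    that this function is on each line through [e]. *)
Lemma approx_representation (rho : E -> R) (M d : R) :
  (forall x y, rho (x + y) = rho x + rho y) ->
  (forall (t : R) x, rho (t%:C *: x) = t * rho x) ->
  (forall x, rho x <= M * snorm x) -> 0 < d ->
  exists e, forall x, rho x - g x e <= d * snorm x.
Proof.
move=> rhoD rhoZ rhoM d0.
pose f x := g x x - rho x *+ 2.
have f_inf : has_inf (range f).
  split; first by exists (f 0), 0.
  exists (- M ^+ 2) => _ [x _ <-]; rewrite /f -sqr_snorm.
  have := sqr_ge0 (snorm x - M); have := rhoM x; nra.
have [_ [e _ <-] fe] := inf_adherent (exprn_gt0 2 d0) f_inf.
exists e => x.
have : (g e x - rho x) ^+ 2 <= d ^+ 2 * g x x.
  apply: quadratic_ge0_discr => [|t]; first exact: semi_inner_ge0 gP x.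
  have := ge_inf (proj2 f_inf) (imageT f (e + t%:C *: x)).
  rewrite /f semi_inner_line rhoD rhoZ; move: fe; rewrite /f; lra.
rewrite -sqr_snorm -exprMn -ler_sqrt ?sqr_ge0 // !sqrtr_sqr.
rewrite (ger0_norm (mulr_ge0 (ltW d0) (snorm_ge0 _))); apply: le_trans.
by rewrite distrC (semi_innerC gP) ler_norm.
Qed.

End Theory.
End SemiInner.

(** * Hilbert spaces and the Riesz representation theorem *)

Section RealInner.
Variable R : realType.
Implicit Types H K : hilbertType R.

Definition rip H (x y : H) : R := complex.Re '[< x, y >].

Lemma rip_sqr H (x : H) : rip x x = nrm x ^+ 2.
Proof. by rewrite /rip inner_norm normE -rmorphXn. Qed.

Lemma innerC H (x y : H) : '[< x, y >] = Num.conj '[< y, x >].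
Proof. by rewrite hermC expr0 mul1r. Qed.

Lemma rip_semi_inner H : semi_inner (@rip H).
Proof.
split.
- by move=> x y; rewrite /rip innerC; case: ('[< y, x >]).
- by move=> x y z; rewrite /rip linearDl /= raddfD.
- move=> t x y; rewrite /rip linearZl_LR /=.
  by case: ('[< x, y >]) => a b /=; rewrite mul0r subr0.
- by move=> a x y; rewrite /rip linearZl_LR /= linearZr /= conjCK.
- by move=> x; rewrite rip_sqr sqr_ge0.
Qed.

Lemma snorm_rip H (x : H) : snorm (@rip H) x = nrm x.
Proof. by rewrite /snorm rip_sqr sqrtr_sqr ger0_norm ?nrm_ge0. Qed.

Lemma nrm_le0 H (x : H) : nrm x <= 0 -> x = 0.
Proof.
move=> x0; apply/eqP; rewrite -normr_eq0 normE.
by have -> : nrm x = 0 by apply/eqP; rewrite eq_le x0 nrm_ge0.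
Qed.

Lemma nrmD H (x y : H) : nrm (x + y) <= nrm x + nrm y.
Proof. by rewrite -lecR rmorphD /= -!normE ler_normD. Qed.

Lemma nrmN H (x : H) : nrm (- x) = nrm x.
Proof. by rewrite /nrm normrN. Qed.

Lemma nrmZ H (a : R[i]) (x : H) : nrm (a *: x) = nrm a * nrm x.
Proof. by rewrite -!snorm_rip (snormZ (rip_semi_inner H)). Qed.

Lemma rip_ext H (x y : H) : (forall z, rip z x = rip z y) -> x = y.
Proof.
have gP := rip_semi_inner H.
move=> h; apply/eqP; rewrite -subr_eq0; apply/eqP/nrm_le0; rewrite -snorm_rip.
apply: (snorm_dual_le gP) => // z.
by rewrite (semi_innerDr gP) (semi_innerNr gP) h subrr mul0r.
Qed.

Lemma rip_le H (x y : H) : `|rip x y| <= nrm x * nrm y.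
Proof.
by rewrite -!snorm_rip; apply: le_snorm_CauchySchwarz (rip_semi_inner H) _ _.
Qed.

Lemma harmonic_small (d : R) :
  0 < d -> exists N, forall n, (N <= n)%N -> harmonic n < d.
Proof.
move=> d0; have /cvgrPdist_lt /(_ d d0) [N _ hN] := @cvg_harmonic R.
by exists N => n /hN; rewrite sub0r normrN ger0_norm ?harmonic_ge0.
Qed.

(** Two approximate representatives differ in norm by at most the sum of their
    errors, so finer and finer ones form a Cauchy sequence. *)
Lemma riesz_representation H (rho : H -> R) (M : R) :
  (forall x y, rho (x + y) = rho x + rho y) ->
  (forall (t : R) x, rho (t%:C *: x) = t * rho x) ->
  (forall x, rho x <= M * nrm x) ->
  exists y, forall x, rho x = rip x y.
Proof.
move=> rhoD rhoZ rhoM; have gP := rip_semi_inner H.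
have apx (n : nat) : exists e, forall x, rho x - rip x e <= harmonic n * nrm x.
  have rhoM' x : rho x <= M * snorm (@rip H) x by rewrite snorm_rip.
  have d0 : 0 < harmonic n :> R by exact: harmonic_gt0.
  have [e he] := approx_representation gP rhoD rhoZ rhoM' d0.
  by exists e => x; rewrite -snorm_rip.
have [e eP] := choice apx.
have rhoN x : rho (- x) = - rho x.
  by have := rhoZ (-1) x; rewrite rmorphN1 scaleN1r mulN1r.
have eC m n : nrm (e m - e n) <= harmonic m + harmonic n.
  rewrite -snorm_rip; apply: (snorm_dual_le gP) => [|x].
    by rewrite addr_ge0 ?harmonic_ge0.
  rewrite (semi_innerDr gP) (semi_innerNr gP) snorm_rip mulrDl.
  have := eP n x; have := eP m (- x).
  rewrite rhoN (semi_innerNl gP) nrmN; lra.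
have ecvg : cvg (e @ \oo).
  apply/cauchy_cvgP/cauchy_exP => eps eps0.
  have epsE : eps = (complex.Re eps)%:C.
    by have /ger0_Im := ltW eps0; case: (eps) => a b /= ->.
  have d0 : 0 < complex.Re eps / 2 by rewrite divr_gt0 // -(ltcR 0) -epsE.
  have [N hN] := harmonic_small d0.
  exists (e N), N => // n /= Nn.
  rewrite -ball_normE /ball_ /= normE epsE ltcR.
  apply: (le_lt_trans (eC _ _)).
  rewrite [X in _ < X](splitr (complex.Re eps)).
  by apply: ltrD; exact: hN.
exists (lim (e @ \oo)) => x.
(* One inequality is enough: the other follows on replacing x by - x. *)
have key z : rho z <= rip z (lim (e @ \oo)).
  apply/ler_addgt0Pr => eps eps0.
  pose d := eps / (2 * (nrm z + 1)).
  have z0 := nrm_ge0 z.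
  have d0 : 0 < d by rewrite divr_gt0 // mulr_gt0 // ltr_wpDl.
  have d0' : 0 < d%:C by rewrite (ltcR 0).
  have /cvgrPdist_lt /(_ _ d0') [N1 _ hN1] := ecvg.
  have [N2 hN2] := harmonic_small d0.
  pose n := maxn N1 N2.
  have := hN1 n (leq_maxl _ _); have := hN2 n (leq_maxr _ _).
  rewrite normE ltcR => h2 h1.
  have := eP n z.
  have := le_trans (ler_norm _) (rip_le z (e n - lim (e @ \oo))).
  rewrite -(nrmN (e n - _)) opprB (semi_innerDr gP) (semi_innerNr gP).
  have h3 : harmonic n * nrm z <= d * nrm z by rewrite ler_wpM2r // ltW.
  have h4 : nrm z * nrm (lim (e @ \oo) - e n) <= nrm z * d.
    by rewrite ler_wpM2l // ltW.
  have : d * (2 * (nrm z + 1)) = eps.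
    by rewrite divfK // gt_eqF // mulr_gt0 // ltr_wpDl.
  lra.
apply/eqP; rewrite eq_le key.
by rewrite -(opprK x) rhoN (semi_innerNl gP) lerN2 key.
Qed.

End RealInner.

(** * Bounded operators and their norms *)

Section BoundedOperators.
Variable R : realType.
Implicit Types H K : hilbertType R.

Lemma opnorm_bound H K (f : 'B(H, K)) x : nrm (f x) <= opnorm f * nrm x.
Proof. by rewrite -lecR rmorphM /= -!normE opnormP. Qed.

Lemma opnorm_le H K (f : 'B(H, K)) c :
  0 <= c -> (forall x, nrm (f x) <= c * nrm x) -> opnorm f <= c.
Proof.
move=> c0 fc; apply: ge_sup.
  by exists (complex.Re `|f 0|), 0 => //=; rewrite normr0.
move=> _ [x /= x1 <-]; apply: (le_trans (fc x)).
by rewrite ler_piMr // -lecR -normE.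
Qed.

Lemma opnorm_ge0 H K (f : 'B(H, K)) : 0 <= opnorm f.
Proof.
apply: ub_le_sup; last by exists 0; rewrite /= ?linear0 ?normr0 //.
exists `|opnorm f| => _ [x /= x1 <-]; apply: (le_trans (opnorm_bound f x)).
apply: (@le_trans _ _ (`|opnorm f| * nrm x)).
  by rewrite ler_wpM2r ?nrm_ge0 ?ler_norm.
by rewrite ler_piMr // -lecR -normE.
Qed.

Lemma ex_boundedOp H K (f : H -> K) c :
  linear f -> (forall x, nrm (f x) <= c * nrm x) ->
  exists F : 'B(H, K), F =1 f.
Proof.
move=> flin fc.
have fb : exists M : R, forall x : H, `|f x| <= M%:C * `|x|.
  by exists c => x; rewrite !normE -rmorphM lecR.
pose lf := GRing.isLinear.Build R[i] H K *:%R f flin.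
pose bf := isBoundedOp.Build R H K f fb.
pose F : 'B(H, K) := HB.pack f lf bf.
by exists F.
Qed.

End BoundedOperators.

(** * Banach limits *)

Section BanachLimit.
Variable R : realType.
Implicit Types u v : nat -> R.

Definition bounded_seq u := exists M, forall n, `|u n| <= M.

Record banach_limit (L : (nat -> R) -> R) : Prop := BanachLimit {
  blimD : forall u v, bounded_seq u -> bounded_seq v ->
    L (fun n => u n + v n) = L u + L v;
  blimZ : forall t u, bounded_seq u -> L (fun n => t * u n) = t * L u;
  blim_le : forall u M, bounded_seq u -> (forall n, u n <= M) -> L u <= M;
  blim_shift : forall u, bounded_seq u -> L (fun n => u n.+1) = L u }.

Lemma cvg_ultra_bounded (U : set_system nat) (UU : UltraFilter U) u :
  bounded_seq u -> cvg (u @ U).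
Proof.
move=> [M uM].
have uUM : (u @ U) [set` `[- M, M]].
  by apply: (@filterE _ U) => n; rewrite /= in_itv /= -ler_norml; exact: uM.
have [p [_ clp]] := @segment_compact R (- M) M _ _ uUM.
apply/cvg_ex; exists p => A Ap.
have [//|UA] := in_ultra_setVsetC (u @^-1` A) UU.
have [x [xA Ax]] : (~` A) `&` A !=set0 by apply: clp.
by [].
Qed.

Lemma arithmetic_meanE u n :
  arithmetic_mean u n = n.+1%:R^-1 * \sum_(0 <= k < n.+1) u k.
Proof. by rewrite /arithmetic_mean /= /series /=. Qed.

(** Cesaro means followed by a limit along an ultrafilter: the means make the
    effect of a shift negligible, the ultrafilter makes the limit exist. *)
Lemma exists_banach_limit : exists L, banach_limit L.
Proof.
have [U [UU /= ooU]] := @ultraFilterLemma nat \oo _.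
have mcvg u : bounded_seq u -> cvg (arithmetic_mean u @ U).
  move=> [M uM]; apply: cvg_ultra_bounded; exists M => n.
  rewrite arithmetic_meanE normrM ger0_norm ?invr_ge0 // ler_pdivrMl ?ltr0n //.
  rewrite mulr_natl big_mkord -[X in _ *+ X]card_ord -sumr_const.
  by apply: (le_trans (ler_norm_sum _ _ _)); apply: ler_sum.
exists (fun u => lim (arithmetic_mean u @ U)); split.
- move=> u v bu bv; apply/cvg_lim => //.
  rewrite (_ : arithmetic_mean _ = arithmetic_mean u \+ arithmetic_mean v).
    by apply: cvgD; exact: mcvg.
  by apply/funext => n; rewrite /= !arithmetic_meanE big_split mulrDr.
- move=> t u bu; apply/cvg_lim => //.
  rewrite (_ : arithmetic_mean _ = fun n => t * arithmetic_mean u n).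
    by apply: cvgMr; exact: mcvg.
  by apply/funext => n; rewrite /= !arithmetic_meanE -mulr_sumr; exact: mulrCA.
- move=> u M bu uM; apply: limr_le; first exact: mcvg.
  apply: nearW => n; rewrite arithmetic_meanE ler_pdivrMl ?ltr0n //.
  rewrite mulr_natl big_mkord -[X in _ *+ X]card_ord -sumr_const.
  exact: ler_sum.
- move=> u bu; have [M uM] := bu; apply/cvg_lim => //.
  pose du n := arithmetic_mean (fun n => u n.+1) n - arithmetic_mean u n.
  suff du0 : du @ U --> (0 : R).
    rewrite (_ : arithmetic_mean _ = du \+ arithmetic_mean u).
      by rewrite -[X in _ --> X]add0r; apply: cvgD => //; exact: mcvg.
    by apply/funext => n /=; rewrite subrK.
  apply: cvg_trans (_ : _ @ \oo --> _).
    by move=> A; exact: ooU.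
  apply/norm_cvg0P.
  (* The sums telescope: du n = (u n.+1 - u 0) / n.+1. *)
  apply: (squeeze_cvgr (f:=fun=> 0) (h:=fun n => (M + M) * harmonic n)).
  + apply: nearW => n; rewrite normr_ge0 /= /du !arithmetic_meanE -mulrBr.
    rewrite big_nat_recr //= [X in _ - X]big_nat_recl //=.
    rewrite [u 0%N + _]addrC opprD addrACA subrr add0r.
    rewrite normrM ger0_norm ?invr_ge0 // mulrC ler_wpM2r ?invr_ge0 //.
    by apply: (le_trans (ler_normB _ _)); apply: lerD.
  + exact: cvg_cst.
  + by rewrite -(mulr0 (M + M)); apply: cvgMr; exact: cvg_harmonic.
Qed.

End BanachLimit.

(** * Weak limits of bounded sequences *)

Section WeakLimit.
Variables (R : realType) (L : (nat -> R) -> R).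
Hypothesis LP : banach_limit L.
Implicit Types H K : hilbertType R.

Lemma blim_shiftn u N : bounded_seq u -> L (fun n => u (n + N)%N) = L u.
Proof.
move=> bu; elim: N => [|N IH].
  by congr L; apply/funext => n; rewrite addn0.
rewrite -IH -(blim_shift LP (u := fun n => u (n + N)%N)).
  by congr L; apply/funext => n; rewrite addnS addSn.
by have [M uM] := bu; exists M.
Qed.

(** A Banach limit ignores vanishing errors, because by shift invariance it
    only sees the tail of the sequence. *)
Lemma blim_le_harmonic u M c :
  bounded_seq u -> (forall n, u n <= M + c * harmonic n) -> L u <= M.
Proof.
move=> bu uM; apply/ler_addgt0Pr => eps eps0.
have : (fun n => c * harmonic n) @ \oo --> 0.
  by rewrite -(mulr0 c); apply: cvgMr; exact: cvg_harmonic.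
move=> /cvgrPdist_lt /(_ eps eps0) [N _ hN].
rewrite -(blim_shiftn N bu); apply: (blim_le LP).
  by have [B uB] := bu; exists B.
move=> n; apply: le_trans (uM _) _; rewrite lerD2l.
have /= := hN (n + N)%N (leq_addl _ _).
by rewrite sub0r normrN => /ltW; apply: le_trans; exact: ler_norm.
Qed.

Lemma blimN u : bounded_seq u -> L (fun n => - u n) = - L u.
Proof.
move=> bu; rewrite -mulN1r -(blimZ LP _ bu); congr L.
by apply/funext => n; rewrite mulN1r.
Qed.

Lemma blim_cst c : L (fun=> c) = c.
Proof.
have b d : bounded_seq (fun=> d : R) by exists `|d|.
apply/eqP; rewrite eq_le (blim_le LP) //=.
by rewrite -lerN2 -blimN // (blim_le LP).
Qed.

Definition bounded_vec H (y : nat -> H) := exists M, forall n, nrm (y n) <= M.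

Lemma bounded_rip H (y : nat -> H) z :
  bounded_vec y -> bounded_seq (fun n => rip z (y n)).
Proof.
move=> [M yM]; exists (nrm z * M) => n; apply: (le_trans (rip_le _ _)).
by rewrite ler_wpM2l ?nrm_ge0.
Qed.

Lemma bounded_vecZ H (a : R[i]) (y : nat -> H) :
  bounded_vec y -> bounded_vec (fun n => a *: y n).
Proof.
by move=> [M yM]; exists (nrm a * M) => n; rewrite nrmZ ler_wpM2l ?nrm_ge0.
Qed.

Lemma bounded_vecD H (y y' : nat -> H) : bounded_vec y -> bounded_vec y' ->
  bounded_vec (fun n => y n + y' n).
Proof.
move=> [M yM] [M' yM']; exists (M + M') => n.
by rewrite (le_trans (nrmD _ _)) ?lerD.
Qed.

Lemma bounded_vec_op H K (F : 'B(H, K)) (y : nat -> H) :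
  bounded_vec y -> bounded_vec (fun n => F (y n)).
Proof.
move=> [M yM]; exists (opnorm F * M) => n; apply: (le_trans (opnorm_bound _ _)).
by rewrite ler_wpM2l ?opnorm_ge0.
Qed.

Definition wlim H (y : nat -> H) : H :=
  xget 0 [set x | forall z, rip z x = L (fun n => rip z (y n))].

Lemma wlimP H (y : nat -> H) z :
  bounded_vec y -> rip z (wlim y) = L (fun n => rip z (y n)).
Proof.
move=> yb; rewrite /wlim; case: xgetP => [x _ /(_ z) //|].
have gP := rip_semi_inner H; have [M yM] := yb.
have [||z0|x xP] :=
    @riesz_representation R H (fun z => L (fun n => rip z (y n))) M.
- move=> a b; rewrite -(blimD LP); try exact: bounded_rip.
  by congr L; apply/funext => n; rewrite (semi_innerDl gP).
- move=> t a; rewrite -(blimZ LP); last exact: bounded_rip.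
  by congr L; apply/funext => n; rewrite (semi_innerRZl gP).
- apply: (blim_le LP) => [|n]; first exact: bounded_rip.
  apply: (le_trans (ler_norm _)); apply: (le_trans (rip_le _ _)).
  by rewrite mulrC ler_wpM2r ?nrm_ge0.
- by move=> /(_ x) /=; case=> w; rewrite xP.
Qed.

Lemma wlimD H (y y' : nat -> H) : bounded_vec y -> bounded_vec y' ->
  wlim (fun n => y n + y' n) = wlim y + wlim y'.
Proof.
move=> yb yb'; have gP := rip_semi_inner H; apply: rip_ext => z.
rewrite wlimP; last exact: bounded_vecD.
rewrite (semi_innerDr gP) !wlimP // -(blimD LP); try exact: bounded_rip.
by congr L; apply/funext => n; rewrite (semi_innerDr gP).
Qed.

Lemma wlimZ H (a : R[i]) (y : nat -> H) : bounded_vec y ->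
  wlim (fun n => a *: y n) = a *: wlim y.
Proof.
move=> yb; have gP := rip_semi_inner H; apply: rip_ext => z.
rewrite wlimP; last exact: bounded_vecZ.
rewrite -[a]conjCK -(semi_innerZl gP) wlimP //; congr L.
by apply/funext => n; rewrite (semi_innerZl gP).
Qed.

Lemma wlim_op H K (F : 'B(H, K)) (y : nat -> H) : bounded_vec y ->
  F (wlim y) = wlim (fun n => F (y n)).
Proof.
move=> yb; apply: rip_ext => z; have gP := rip_semi_inner K.
rewrite wlimP; last exact: bounded_vec_op.
(* w is the value at z of the adjoint of F. *)
have [||x|w wP] := @riesz_representation R H (fun x => rip z (F x))
    (nrm z * opnorm F).
- by move=> a b; rewrite linearD (semi_innerDr gP).
- by move=> t a; rewrite linearZ (semi_innerRZr gP).
- apply: (le_trans (ler_norm _)); apply: (le_trans (rip_le _ _)).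
  by rewrite -mulrA ler_wpM2l ?nrm_ge0 ?opnorm_bound.
rewrite wP (semi_innerC (rip_semi_inner H)) wlimP //; congr L.
by apply/funext => n; rewrite (semi_innerC (rip_semi_inner H)) -wP.
Qed.

Lemma wlim_cst H (x : H) : wlim (fun=> x) = x.
Proof.
apply: rip_ext => z; rewrite wlimP ?blim_cst //.
by exists (nrm x).
Qed.

Lemma wlim_shift H (y : nat -> H) : bounded_vec y ->
  wlim (fun n => y n.+1) = wlim y.
Proof.
move=> yb; have [M yM] := yb; apply: rip_ext => z; rewrite !wlimP //.
  by rewrite (blim_shift LP (u := fun n => rip z (y n))) //; exact: bounded_rip.
by exists M.
Qed.

Lemma wlim_nrm_le H (y : nat -> H) M c : 0 <= M -> 0 <= c ->
  (forall n, nrm (y n) <= M + c * harmonic n) -> nrm (wlim y) <= M.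
Proof.
move=> M0 c0 yM; have gP := rip_semi_inner H.
have yb : bounded_vec y.
  exists (M + c) => n; apply: (le_trans (yM n)); rewrite lerD2l ler_piMr //.
  by rewrite invf_le1 // ler1n.
rewrite -snorm_rip; apply: (snorm_dual_le gP) => // z; rewrite wlimP // snorm_rip.
apply: (@blim_le_harmonic _ _ (c * nrm z)); first exact: bounded_rip.
move=> n; apply: (le_trans (ler_norm _)); apply: (le_trans (rip_le _ _)).
by rewrite mulrAC -mulrDl mulrC ler_wpM2r ?nrm_ge0.
Qed.

Lemma wlim_eq H (y y' : nat -> H) c :
  bounded_vec y -> bounded_vec y' -> 0 <= c ->
  (forall n, nrm (y n - y' n) <= c * harmonic n) -> wlim y = wlim y'.
Proof.
move=> yb yb' c0 yc; apply/eqP; rewrite -subr_eq0; apply/eqP/nrm_le0.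
rewrite -scaleN1r -wlimZ // -wlimD //; last exact: bounded_vecZ.
by apply: (@wlim_nrm_le _ _ _ c) => // n; rewrite add0r scaleN1r.
Qed.

Lemma wlim_pointwise_op H K (F : nat -> 'B(H, K)) c : 0 <= c ->
  (forall n x, nrm (F n x) <= c * nrm x) ->
  exists2 Y : 'B(H, K), forall x, Y x = wlim (fun n => F n x) &
    forall x, nrm (Y x) <= c * nrm x.
Proof.
move=> c0 Fc.
have Fb x : bounded_vec (fun n => F n x) by exists (c * nrm x).
pose Yf x := wlim (fun n => F n x).
have Yc x : nrm (Yf x) <= c * nrm x.
  apply: (@wlim_nrm_le _ _ _ 0) => // [|n]; first by rewrite mulr_ge0 ?nrm_ge0.
  by rewrite mul0r addr0.
have [|Y YE] := @ex_boundedOp R H K Yf c _ Yc; last first.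
  by exists Y => x; rewrite YE //; exact: Yc.
move=> a x x'; rewrite /Yf -wlimZ // -wlimD //; last exact: bounded_vecZ.
by congr (wlim _); apply/funext => n; rewrite linearP.
Qed.

End WeakLimit.

(** * Extension of maps dominated by a semi-norm *)

Section Extension.
Variables (R : realType) (E H : lmodType R[i]) (g : E -> E -> R).
Hypothesis gP : semi_inner g.
Variable J : {linear H -> E}.

(** [J h] is, up to [d], the [g]-orthogonal projection of [k] onto the range of
    [J]: the residue [k - J h] is almost orthogonal to that range. *)
Definition approx_proj (k : E) (d : R) (h : H) :=
  forall x, g (J x) (k - J h) <= d * snorm g (J x).

Lemma semi_inner_comp : semi_inner (fun x y => g (J x) (J y)).
Proof.
split=> [x y|x y z|t x y|a x y|x]; rewrite ?linearD ?linearZ.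
- exact: semi_innerC.
- exact: semi_innerDl.
- exact: semi_innerRZl.
- exact: semi_innerZl.
- exact: semi_inner_ge0.
Qed.

Lemma ex_approx_proj k d : 0 < d -> exists h, approx_proj k d h.
Proof.
move=> d0; have [|||h hP] := @approx_representation R H _ semi_inner_comp
    (fun x => g (J x) k) (snorm g k) d _ _ _ d0.
- by move=> x y; rewrite linearD (semi_innerDl gP).
- by move=> t x; rewrite linearZ (semi_innerRZl gP).
- move=> x; apply: (le_trans (ler_norm _)).
  by rewrite mulrC; exact: le_snorm_CauchySchwarz.
by exists h => x; rewrite (semi_innerDr gP) (semi_innerNr gP); exact: hP.
Qed.

Lemma approx_projJ h d : 0 <= d -> approx_proj (J h) d h.
Proof. by move=> d0 x; rewrite subrr (semi_inner0r gP) mulr_ge0 ?snorm_ge0. Qed.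

Lemma approx_projD k k' d d' h h' : approx_proj k d h -> approx_proj k' d' h' ->
  approx_proj (k + k') (d + d') (h + h').
Proof.
move=> kh kh' x; rewrite linearD opprD addrACA (semi_innerDr gP) mulrDl.
exact: lerD.
Qed.

Lemma approx_projZ (a : R[i]) k d h : approx_proj k d h ->
  approx_proj (a *: k) (nrm a * d) (a *: h).
Proof.
move=> kh x; rewrite linearZ -scalerBr -[a in X in g _ X]conjCK.
rewrite -(semi_innerZl gP) -linearZ; apply: (le_trans (kh _)).
by rewrite linearZ (snormZ gP) /nrm norm_conjC mulrCA mulrA.
Qed.

Lemma approx_proj_unique k d d' h h' : 0 <= d -> 0 <= d' ->
  approx_proj k d h -> approx_proj k d' h' -> snorm g (J (h - h')) <= d + d'.
Proof.
move=> d0 d0' kh kh'.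
apply: (snorm_dual_le semi_inner_comp) => [|x]; first exact: addr_ge0.
have := kh' x; have := kh (- x).
rewrite !linearN !linearD (snormN gP) (semi_innerNl gP) linearN.
rewrite !(semi_innerDr gP) !(semi_innerNr gP) mulrDl /=.
rewrite -[snorm (fun _ _ => _) x]/(snorm g (J x)).
lra.
Qed.

Lemma approx_proj_snorm k d h : 0 <= d -> approx_proj k d h ->
  snorm g (J h) <= snorm g k + d.
Proof.
move=> d0 kh; apply: (snorm_dual_le semi_inner_comp) => [|x].
  by rewrite addr_ge0 ?snorm_ge0.
have := kh (- x); rewrite linearN (snormN gP) (semi_innerNl gP).
have := le_trans (ler_norm _) (le_snorm_CauchySchwarz gP (J x) k).
rewrite (semi_innerDr gP) (semi_innerNr gP).
rewrite -[snorm (fun _ _ => _) x]/(snorm g (J x)).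
lra.
Qed.

(** [D k] is the limit of [C h] for [h] an ever better approximate projection
    of [k]. It depends only on [k], as [C] is bounded by [g] and approximate
    projections are unique up to their errors; hence linearity. *)
Lemma contraction_extension (M : hilbertType R) (C : {linear H -> M}) :
  (forall h, nrm (C h) <= snorm g (J h)) ->
  exists D : E -> M, [/\ linear D, forall h, D (J h) = C h &
    forall k, nrm (D k) <= snorm g k].
Proof.
move=> Cg; have [L LP] := exists_banach_limit R.
have apx k : exists h : nat -> H, forall n, approx_proj k (harmonic n) (h n).
  by have [f fP] := choice (fun n => ex_approx_proj k (harmonic_gt0 n)); exists f.
have [p pP] := choice apx.
have h0 n : 0 <= harmonic n :> R by exact: harmonic_ge0.
have h1 n : harmonic n <= 1 :> R by rewrite invf_le1 // ler1n.
have bnd k (q : nat -> H) c : 0 <= c ->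
    (forall n, approx_proj k (c * harmonic n) (q n)) ->
    bounded_vec (fun n => C (q n)).
  move=> c0 kq; exists (snorm g k + c) => n; apply: (le_trans (Cg _)).
  have := approx_proj_snorm (mulr_ge0 c0 (h0 n)) (kq n).
  have := h1 n; nra.
have uniq k (q : nat -> H) c : 0 <= c ->
    (forall n, approx_proj k (c * harmonic n) (q n)) ->
    wlim L (fun n => C (p k n)) = wlim L (fun n => C (q n)).
  move=> c0 kq; apply: (wlim_eq LP (c := 1 + c)).
  - by apply: (bnd k _ 1) => // n; rewrite mul1r.
  - exact: bnd kq.
  - exact: addr_ge0.
  move=> n; rewrite -linearB mulrDl mul1r; apply: (le_trans (Cg _)).
  by apply: approx_proj_unique (pP _ _) (kq _) => //; rewrite mulr_ge0.
have pb k : bounded_vec (fun n => C (p k n)).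
  by apply: (bnd k _ 1) => // n; rewrite mul1r.
exists (fun k => wlim L (fun n => C (p k n))); split.
- move=> a k k'.
  rewrite (uniq _ (fun n => a *: p k n + p k' n) (nrm a + 1)).
  + rewrite -(wlimZ LP) // -(wlimD LP) //; last exact: bounded_vecZ.
    by congr (wlim L); apply/funext => n; rewrite linearP.
  + by rewrite addr_ge0 ?nrm_ge0.
  + move=> n; rewrite mulrDl mul1r.
    by apply: approx_projD => //; exact: approx_projZ.
- move=> h; rewrite (uniq _ (fun=> h) 0) ?(wlim_cst LP) // => n.
  by apply: approx_projJ; rewrite mul0r.
- move=> k; apply: (wlim_nrm_le LP (c := 1)) => // [|n]; first exact: snorm_ge0.
  by rewrite mul1r; apply: (le_trans (Cg _)); exact: approx_proj_snorm.
Qed.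

End Extension.

(** * Co-isometries and Parrott's completion problem *)

Section Completion.
Variable R : realType.
Implicit Types H K : hilbertType R.

(** If no vector represented [<V _, y>], then [adjoint V y] would be the default
    value [0], so that [y = V (adjoint V y) = 0]; but [0] is represented by
    [0]. *)
Lemma coisometric_adjointP K (V : 'B(K)) : coisometric V ->
  forall x y, rip x (adjoint V y) = rip (V x) y.
Proof.
move=> Vco x y.
suff /(_ x) h : forall z, '[< V z, y >] = '[< z, adjoint V y >].
  by rewrite /rip h.
have [[z zP]|noz] := pselect (exists z, forall x, '[< V x, y >] = '[< x, z >]).
  by rewrite (adjoint_unique zP).
have y0 : y = 0.
  rewrite -(Vco y) /adjoint; case: xgetP => [z _ /= zP|_]; last exact: linear0.
  by case: noz; exists z.
have adj0 : adjoint V 0 = 0 by apply: adjoint_unique => w; rewrite !linear0r.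
by move=> z; rewrite y0 adj0 !linear0r.
Qed.

Lemma coisometric_adjoint_linear K (V : 'B(K)) :
  coisometric V -> linear (adjoint V).
Proof.
move=> Vco a x y; have gP := rip_semi_inner K; apply: rip_ext => z.
rewrite (semi_innerDr gP) -[a in RHS]conjCK -(semi_innerZl gP).
rewrite !coisometric_adjointP //.
by rewrite linearZ (semi_innerDr gP) (semi_innerZl gP) conjCK.
Qed.

(** Pythagoras: the range of [adjoint V] is orthogonal to the kernel of [V],
    and [adjoint V] is isometric. *)
Lemma coisometric_pythagoras K (V : 'B(K)) u w : coisometric V -> V u = 0 ->
  nrm (u + adjoint V w) ^+ 2 = nrm u ^+ 2 + nrm w ^+ 2.
Proof.
move=> Vco Vu; have gP := rip_semi_inner K.
rewrite -!rip_sqr (semi_innerDl gP) !(semi_innerDr gP).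
rewrite (semi_innerC gP _ u) !coisometric_adjointP // Vu Vco.
by rewrite (semi_innerC gP 0) (semi_inner0r gP) addr0 add0r.
Qed.

(** The form of the operator [c^2 - B* B]. *)
Definition defect_form H K (B : {linear H -> K}) (c : R) (x y : H) : R :=
  c ^+ 2 * rip x y - rip (B x) (B y).

Lemma defect_semi_inner H K (B : {linear H -> K}) c :
  (forall x, nrm (B x) <= c * nrm x) -> semi_inner (defect_form B c).
Proof.
move=> Bc; have gH := rip_semi_inner H; have gK := rip_semi_inner K.
rewrite /defect_form; split.
- by move=> x y; rewrite (semi_innerC gH) (semi_innerC gK).
- by move=> x y z; rewrite linearD (semi_innerDl gH) (semi_innerDl gK); ring.
- by move=> t x y; rewrite linearZ (semi_innerRZl gH) (semi_innerRZl gK); ring.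
- by move=> a x y; rewrite !linearZ (semi_innerZl gH) (semi_innerZl gK).
- move=> x; rewrite !rip_sqr -exprMn subr_ge0.
  by rewrite lerXn2r ?nnegrE ?nrm_ge0 // (le_trans (nrm_ge0 _) (Bc x)).
Qed.

Lemma bounded_extension H K1 K2 (J : {linear H -> K2}) (A : {linear H -> K1}) c :
  0 <= c -> (forall h, nrm (A h) <= c * nrm (J h)) ->
  exists Y : 'B(K2, K1), (forall h, Y (J h) = A h) /\
    (forall k, nrm (Y k) <= c * nrm k).
Proof.
move=> c0 Ac; pose B : {linear K2 -> K1} := \0.
have Bc k : nrm (B k) <= c * nrm k.
  by rewrite /nrm normr0 mulr_ge0 ?nrm_ge0.
have gP := defect_semi_inner Bc.
have sg k : snorm (defect_form B c) k = c * nrm k.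
  rewrite /snorm /defect_form !rip_sqr [nrm (B k)]/nrm normr0 expr0n subr0.
  by rewrite -exprMn sqrtr_sqr ger0_norm ?mulr_ge0 ?nrm_ge0.
have [|D [Dlin DJ Dg]] := @contraction_extension R K2 H _ gP J K1 A.
  by move=> h; rewrite sg.
have [|Y YE] := @ex_boundedOp R K2 K1 D c Dlin.
  by move=> k; rewrite -sg.
by exists Y; split=> [h|k]; rewrite YE // -sg.
Qed.

(** The component [adjoint V (V (Y k))] of [Y k] is forced to be
    [adjoint V (B k)]. The other component, along the projection [P] onto the
    kernel of [V], has to extend [P A] and its norm must be bounded by the
    defect form of [B]. The two bounds add up by Pythagoras. *)
Lemma parrott_extension H K1 K2 (J : {linear H -> K2}) (A : {linear H -> K1})
    (B : 'B(K2, K1)) (V : 'B(K1)) c : 0 <= c -> coisometric V ->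
  (forall h, nrm (A h) <= c * nrm (J h)) ->
  (forall k, nrm (B k) <= c * nrm k) ->
  (forall h, V (A h) = B (J h)) ->
  exists Y : 'B(K2, K1), [/\ forall h, Y (J h) = A h,
    forall k, V (Y k) = B k & forall k, nrm (Y k) <= c * nrm k].
Proof.
move=> c0 Vco Ac Bc VAB; have gP := defect_semi_inner Bc.
have adjlin := coisometric_adjoint_linear Vco.
pose P x := x - adjoint V (V x).
have Plin : linear P.
  by move=> a x y; rewrite /P linearP adjlin scalerBr addrACA -opprD.
have VP x : V (P x) = 0 by rewrite /P linearB /= Vco subrr.
have PE x : P x + adjoint V (V x) = x by rewrite subrK.
have nP x : nrm x ^+ 2 = nrm (P x) ^+ 2 + nrm (V x) ^+ 2.
  by rewrite -(coisometric_pythagoras _ Vco (VP x)) PE.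
have PAlin : linear (P \o A) by move=> a x y; rewrite /= linearP Plin.
pose C : {linear H -> K1} :=
  HB.pack (P \o A) (GRing.isLinear.Build _ _ _ _ _ PAlin).
have [|D [Dlin DJ Dg]] := @contraction_extension R K2 H _ gP J K1 C.
  move=> h; rewrite -(ger0_norm (nrm_ge0 (C h))) -sqrtr_sqr ler_wsqrtr //.
  rewrite /defect_form /= -VAB !rip_sqr lerBrDr -nP -exprMn.
  by rewrite lerXn2r ?nnegrE ?nrm_ge0 // (le_trans (nrm_ge0 _) (Ac h)).
(* D need not take its values in the kernel of V, but P D is as good. *)
have Yc k : nrm (P (D k) + adjoint V (B k)) <= c * nrm k.
  rewrite -ler_sqr ?nnegrE ?mulr_ge0 ?nrm_ge0 // coisometric_pythagoras // exprMn.
  have : nrm (D k) ^+ 2 <= c ^+ 2 * nrm k ^+ 2 - nrm (B k) ^+ 2.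
    have := Dg k; rewrite -ler_sqr ?nnegrE ?nrm_ge0 ?snorm_ge0 //.
    by rewrite (sqr_snorm gP) /defect_form /= !rip_sqr.
  have := nP (D k); have := sqr_ge0 (nrm (V (D k))); lra.
have [|Y YE] := @ex_boundedOp R K2 K1 (fun k => P (D k) + adjoint V (B k)) c _ Yc.
  move=> a x y; rewrite Dlin Plin linearP adjlin.
  by rewrite addrACA -scalerDr.
exists Y; split=> [h|k|k]; rewrite YE //.
- have adj0 : adjoint V 0 = 0 by apply: adjoint_unique => w; rewrite !linear0r.
  by rewrite DJ -VAB [P (C h)]/P VP adj0 subr0 PE.
- by rewrite linearD /= VP add0r Vco.
Qed.

(** * Intertwining extensions *)

(** The iterates [Y_(n+1)] of the completion step, [V Y_(n+1) = Y_n W], need not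
    converge; shift invariance of the Banach limit removes the mismatch of
    indices. *)
Lemma intertwining_extension H K1 K2 (J : {linear H -> K2})
    (A : {linear H -> K1}) (S : H -> H) (V : 'B(K1)) (W : 'B(K2)) c :
  0 <= c -> coisometric V ->
  (forall h, nrm (A h) <= c * nrm (J h)) ->
  (forall k, nrm (W k) <= nrm k) ->
  (forall h, W (J h) = J (S h)) -> (forall h, V (A h) = A (S h)) ->
  exists Y : 'B(K2, K1), [/\ forall h, Y (J h) = A h,
    forall k, V (Y k) = Y (W k) & forall k, nrm (Y k) <= c * nrm k].
Proof.
move=> c0 Vco Ac W1 WJ VA; have [L LP] := exists_banach_limit R.
pose good (Y : 'B(K2, K1)) :=
  (forall h, Y (J h) = A h) /\ (forall k, nrm (Y k) <= c * nrm k).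
have [Y0 Y0good] : exists Y, good Y := bounded_extension c0 Ac.
have step (Y : {Y | good Y}) : exists Y' : {Y | good Y},
    forall k, V (sval Y' k) = sval Y (W k).
  case: Y => Y [YJ Yc] /=.
  have YWc k : nrm ((Y \o W) k) <= c * nrm k.
    by apply: (le_trans (Yc _)); rewrite ler_wpM2l.
  have [|Y' [Y'J VY' Y'c]] := parrott_extension c0 Vco Ac YWc.
    by move=> h; rewrite /= WJ YJ VA.
  by exists (exist _ Y' (conj Y'J Y'c)).
have [s sP] := choice step.
pose y n := sval (iter n s (exist _ Y0 Y0good)).
have yc n k : nrm (y n k) <= c * nrm k by rewrite /y; case: (iter _ _ _) => ? [].
have yJ n h : y n (J h) = A h by rewrite /y; case: (iter _ _ _) => ? [].
have yb k : bounded_vec (fun n => y n k) by exists (c * nrm k).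
have [Y YE Yc] := wlim_pointwise_op LP c0 yc.
exists Y; split=> // [h|k].
  rewrite YE (_ : (fun n => y n _) = fun=> A h) ?(wlim_cst LP) //.
  by apply/funext => n; rewrite yJ.
rewrite !YE (wlim_op LP) // -(wlim_shift LP (y := fun n => V (y n k))).
  by congr (wlim L); apply/funext => n; exact: sP.
exact: bounded_vec_op.
Qed.

Lemma embedding_nrm H K (J : {linear H -> K}) h :
  embedding J -> nrm (J h) = nrm h.
Proof.
move=> Je; apply/eqP; rewrite -(@eqrXn2 _ 2) ?nrm_ge0 //.
by rewrite -!rip_sqr /rip Je.
Qed.

End Completion.

Theorem theorem6p3 (R : realType) (H K1 K2 : hilbertType R)
    (J1 : {linear H -> K1}) (J2 : {linear H -> K2})
    (hJ1 : embedding J1) (hJ2 : embedding J2)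
    (Q T1 T2 X : 'B(H))
    (hT1 : contraction_op T1) (hT2 : contraction_op T2)
    (hT2Q : contraction_op (T2 \o Q))
    (hX : T1 \o X =1 X \o T2 \o Q)
    (V1 : 'B(K1)) (V2 : 'B(K2))
    (hV1 : coisometric_extension J1 T1 V1)
    (hV2 : coisometric_extension J2 T2 V2)
    (Qbar : 'B(K2))
    (hQbar : extends J2 J2 Q Qbar)
    (hV2Qbar : contraction_op (V2 \o Qbar)) :
  exists Y : 'B(K2, K1),
    [/\ extends J1 J2 X Y, norm_preserving X Y & V1 \o Y =1 Y \o V2 \o Qbar].
Proof.
have [V1T1 V1co] := hV1; have [V2T2 _] := hV2.
have c0 := opnorm_ge0 X.
have Ac h : nrm ((J1 \o X) h) <= opnorm X * nrm (J2 h).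
  by rewrite /= (embedding_nrm _ hJ1) (embedding_nrm _ hJ2) opnorm_bound.
have W1 k : nrm ((V2 \o Qbar) k) <= nrm k.
  by apply: (le_trans (opnorm_bound _ k)); rewrite ler_piMl ?nrm_ge0.
have WJ h : (V2 \o Qbar) (J2 h) = J2 ((T2 \o Q) h) by rewrite /= hQbar V2T2.
have V1A h : V1 ((J1 \o X) h) = (J1 \o X) ((T2 \o Q) h).
  by have /= XTQ := hX h; rewrite /= V1T1 XTQ.
have [Y [YJ VY Yc]] := intertwining_extension c0 V1co Ac W1 WJ V1A.
exists Y; split=> //; apply/eqP; rewrite eq_le; apply/andP; split.
  exact: opnorm_le.
apply: opnorm_le => [|h]; first exact: opnorm_ge0.
rewrite -(embedding_nrm h hJ2) -(embedding_nrm (X h) hJ1).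
by have /= <- := YJ h; exact: opnorm_bound.
Qed.
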